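(* Let $\mathcal A_{\Lambda,k}^{\mathrm{cl},\mathrm{PFE}}\subset Y_{N,k}^{\mathrm{cl}}$ be a reduced clean package class in the finite-dimensional normed space $Y_{N,k}^{\mathrm{cl}}$, with clean gauge subspace $G_{\Lambda,k}^{\mathrm{cl}}$ and PFE detector $M_{\Lambda,k}^{\mathrm{PFE}}\ge0$. Assume: (a) $\mathcal A_{\Lambda,k}^{\mathrm{cl},\mathrm{PFE}}$ is stable under quotient normalization; (b) the clean unit quotient section $S_{\Lambda,k}^{\mathrm{cl},\mathrm{PFE}}:=\{D_k^{\mathrm{cl}}\in\mathcal A_{\Lambda,k}^{\mathrm{cl},\mathrm{PFE}}:\operatorname{dist}_{\mathrm{cl}}(D_k^{\mathrm{cl}},G_{\Lambda,k}^{\mathrm{cl}})=1\}$ is compact; (c) $M_{\Lambda,k}^{\mathrm{PFE}}$ is lower semicontinuous and positively homogeneous; (d) PFE zero-set rigidity holds: $M_{\Lambda,k}^{\mathrm{PFE}}(D_k^{\mathrm{cl}})=0$ implies $D_k^{\mathrm{cl}}\in G_{\Lambda,k}^{\mathrm{cl}}$. Then $$\mu_{\Lambda,k}^{\mathrm{PFE}}:=\inf_{D_k^{\mathrm{cl}}\in S_{\Lambda,k}^{\mathrm{cl},\mathrm{PFE}}}M_{\Lambda,k}^{\mathrm{PFE}}(D_k^{\mathrm{cl}})>0,$$ and for every $D_k^{\mathrm{cl}}\in\mathcal A_{\Lambda,k}^{\mathrm{cl},\mathrm{PFE}}$, $$M_{\Lambda,k}^{\mathrm{PFE}}(D_k^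{\mathrm{cl}})\ge\mu_{\Lambda,k}^{\mathrm{PFE}}\operatorname{dist}_{\mathrm{cl}}(D_k^{\mathrm{cl}},G_{\Lambda,k}^{\mathrm{cl}}).$$
   Context: $\operatorname{dist}_{\mathrm{cl}}(\cdot,G_{\Lambda,k}^{\mathrm{cl}})$ is the distance in $Y_{N,k}^{\mathrm{cl}}$ to the subspace $G_{\Lambda,k}^{\mathrm{cl}}$. The PFE (pressure--flux--energy) detector $M_{\Lambda,k}^{\mathrm{PFE}}$ is a sum, with positive weights, of norms of an observation map $O_k^{\mathrm{cl}}$ and of pressure, harmonic, flux, energy and gate channel maps on $Y_{N,k}^{\mathrm{cl}}$; rigidity (d) holds for instance when the combined linear channel map $T_{\Lambda,k}^{\mathrm{PFE}}$ has kernel $G_{\Lambda,k}^{\mathrm{cl}}$. ''Stable under quotient normalization'' means: if $D$ is in the class and $d:=\operatorname{dist}_{\mathrm{cl}}(D,G_{\Lambda,k}^{\mathrm{cl}})>0$, then $d^{-1}D$ is in the class. Positive homogeneity: $M(tD)=tM(D)$ for $t>0$. The infimum over an empty set is $+\infty$, with $(+\infty)\cdot0=0$. *)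

(* Defs.v *)
From HB Require Import structures.
From mathcomp Require Import all_boot all_order all_algebra.
From mathcomp Require Import all_classical all_reals all_analysis.
Import Order.TTheory GRing.Theory Num.Theory.
Import numFieldNormedType.Exports.

Set Implicit Arguments.
Unset Strict Implicit.
Unset Printing Implicit Defensive.

Local Open Scope classical_set_scope.
Local Open Scope ring_scope.

#[short(type="finNormedModType")]
HB.structure Definition FinNormedModule (R : realType) :=
  {V of NormedModule R V & Vector R V}.

Section PFE.
Variables (R : realType) (Y : finNormedModType R).

Variant pfe_channel :=
  Observation | Pressure | Harmonic | Flux | Energy | Gate.

(* The channel maps are arbitrary functions: the regularity of the detector is
   a hypothesis on the weighted sum of norms, not on each channel. *)
Record pfe_detector := PFEDetector {
  pfe_space : pfe_channel -> normedModType R;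
  pfe_map : forall c : pfe_channel, Y -> pfe_space c;
  pfe_weight : pfe_channel -> R;
  pfe_weight_gt0 : forall c, 0 < pfe_weight c }.

Definition pfe_value (M : pfe_detector) (D : Y) : R :=
  let term c := pfe_weight M c * `|pfe_map M c D| in
  term Observation + term Pressure + term Harmonic
    + term Flux + term Energy + term Gate.

Definition dist_cl (D : Y) (G : {vspace Y}) : R :=
  inf [set `|D - g| | g in [set` G]].

Definition quotient_normalization_stable (A : set Y) (G : {vspace Y}) :=
  forall D, A D -> 0 < dist_cl D G -> A ((dist_cl D G)^-1 *: D).

Definition unit_quotient_section (A : set Y) (G : {vspace Y}) : set Y :=
  [set D | A D /\ dist_cl D G = 1].

Definition positively_homogeneous (f : Y -> R) :=
  forall (t : R) (D : Y), 0 < t -> f (t *: D) = t * f D.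

(* Extended-real valued, so that the infimum over an empty section is +oo;
   the product +oo * 0 is 0 in \bar R. *)
Definition pfe_mu (A : set Y) (G : {vspace Y}) (M : pfe_detector) : \bar R :=
  ereal_inf [set (pfe_value M D)%:E | D in unit_quotient_section A G].

End PFE.

Coercion pfe_value : pfe_detector >-> Funclass.

(* Main.v *)
(* The infimum of a positive lower semicontinuous function over a compact set is
   positive; rigidity makes the detector positive on the unit section, and
   rescaling by the inverse distance carries a class element at positive
   distance into that section. *)
Require Import Defs.
From HB Require Import structures.
From mathcomp Require Import all_boot all_order all_algebra.
From mathcomp Require Import all_classical all_reals all_analysis.
Import Order.TTheory GRing.Theory Num.Theory.
Import numFieldNormedType.Exports.
Set Implicit Arguments.
Unset Strict Implicit.
Unset Printing Implicit Defensive.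
Local Open Scope classical_set_scope.
Local Open Scope ring_scope.

(** Each point has a neighbourhood on which [f] exceeds every small enough [e]; compactness, in its
    near-covering form, yields one [e > 0] valid on all of [K]. This also covers empty [K], where
    the infimum is [+oo]. *)
Lemma lower_semicontinuous_ereal_inf_gt0 (R : realType) (X : topologicalType)
    (K : set X) (f : X -> R) :
  compact K -> lower_semicontinuous (fun x => (f x)%:E) ->
  (forall x, K x -> 0 < f x) -> (0 < ereal_inf [set (f x)%:E | x in K])%E.
Proof.
move=> /compact_near_coveringP Kcov flsc f_gt0.
have /filter_ex [e [e_gt0 Ke]] : \forall e \near 0^'+,
    0 < e /\ K `<=` (fun x => e < f x).
  near=> e; split; first by near: e; exact: nbhs_right_gt.
  near: e; apply: (Kcov R (0^'+) (fun e x => e < f x)) => x Kx.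
  (* Halving leaves room: [f] stays above [f x / 2] on [V], hence above every [e < f x / 2]. *)
  have /flsc [V xV Vf] : ((f x / 2)%:E < (f x)%:E)%E.
    by rewrite lte_fin ltr_pdivrMr// ltr_pMr ?f_gt0// ltr1n.
  exists (V, [set e | e < f x / 2]).
    by split=> //=; apply: nbhs_right_lt; rewrite divr_gt0 ?f_gt0.
  by move=> [y e]/= [/Vf + e_lt]; rewrite lte_fin; exact: lt_trans.
apply: (@lt_le_trans _ _ e%:E); first by rewrite lte_fin.
by apply: le_ereal_inf_tmp => _ [x Kx <-]; rewrite lee_fin ltW// Ke.
Unshelve. all: by end_near. Qed.

Section Distance.
Variables (R : realType) (Y : finNormedModType R) (G : {vspace Y}).
Implicit Types D : Y.

Let dist_set_neq0 D : [set `|D - g| | g in [set` G]] !=set0.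
Proof. by exists `|D - 0|, 0 => //=; exact: mem0v. Qed.

Lemma dist_cl_ge0 D : 0 <= dist_cl D G.
Proof. by apply: lb_le_inf => // _ [g _ <-]. Qed.

Lemma dist_cl_le D g : g \in G -> dist_cl D G <= `|D - g|.
Proof. by move=> Gg; apply: ge_inf; [exists 0 => _ [h _ <-] | exists g]. Qed.

Lemma dist_cl_mem D : D \in G -> dist_cl D G = 0.
Proof.
move=> GD; apply/eqP; rewrite eq_le dist_cl_ge0 andbT.
by rewrite (le_trans (dist_cl_le D GD))// subrr normr0.
Qed.

(** [G] is closed under scaling, so scaling competitors [g] gives one inequality; the other is that
    same inequality for [t^-1] and [t *: D]. *)
Lemma dist_clZ t D : 0 < t -> dist_cl (t *: D) G = t * dist_cl D G.
Proof.
have le_distZ s E : 0 < s -> dist_cl (s *: E) G <= s * dist_cl E G.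
  move=> s_gt0; rewrite -ler_pdivrMl//; apply: lb_le_inf => // _ [g Gg <-].
  rewrite ler_pdivrMl// -[X in X * _]gtr0_norm// -normrZ scalerBr.
  by apply: dist_cl_le; exact: memvZ.
move=> t_gt0; apply/eqP; rewrite eq_le le_distZ//= -ler_pdivlMl//.
by rewrite -{1}(scalerK (lt0r_neq0 t_gt0) D) le_distZ// invr_gt0.
Qed.

End Distance.

Lemma pfe_value_ge0 (R : realType) (Y : finNormedModType R)
    (M : pfe_detector Y) (D : Y) : 0 <= M D.
Proof. by rewrite /pfe_value !addr_ge0// mulr_ge0// ltW// pfe_weight_gt0. Qed.

Theorem theorem12p23 (R : realType) (Y : finNormedModType R)
    (A : set Y) (G : {vspace Y}) (M : pfe_detector Y)
    (hA : quotient_normalization_stable A G)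
    (hS : compact (unit_quotient_section A G))
    (hM_lsc : lower_semicontinuous (fun D : Y => (M D)%:E))
    (hM_hom : positively_homogeneous M)
    (hM_rigid : forall D : Y, A D -> M D = 0 -> D \in G) :
  (0 < pfe_mu A G M)%E /\
  (forall D : Y, A D -> ((M D)%:E >= pfe_mu A G M * (dist_cl D G)%:E)%E).
Proof.
split.
  apply: lower_semicontinuous_ereal_inf_gt0 hS hM_lsc _ => D [AD dist1].
  rewrite lt_neqAle pfe_value_ge0 andbT eq_sym; apply/eqP => MD0.
  have /eqP := dist_cl_mem (hM_rigid _ AD MD0).
  by rewrite dist1 oner_eq0.
move=> D AD; have := dist_cl_ge0 G D; rewrite le_eqVlt => /predU1P[<-|d_gt0].
  (* At distance 0 the right side vanishes even if [pfe_mu] is [+oo]. *)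
  by rewrite mule0 lee_fin pfe_value_ge0.
set d := dist_cl D G in d_gt0 *.
(* After division by [d], homogeneity turns the bound into [pfe_mu A G M <= M (d^-1 *: D)], where
   [d^-1 *: D] lies in the unit section. *)
rewrite -lee_pdivlMr// -EFinM mulrC -hM_hom ?invr_gt0//.
apply: ereal_inf_lbound; exists (d^-1 *: D) => //; split; first exact: hA.
by rewrite dist_clZ ?invr_gt0// mulVf// lt0r_neq0.
Qed.
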